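(* Let $\mathbf M\in\mathbb S^n_{++}$ and $\mathbf X,\mathbf Y\in\mathbb S^n_{++}$. Let $\mathbf O$ be the orthogonal polar factor of $\mathbf Y^{1/2}\mathbf M^{-1}\mathbf X^{1/2}$, let $c(t)=(1-t)\mathbf M^{-1/2}\mathbf X^{1/2}+t\,\mathbf M^{-1/2}\mathbf Y^{1/2}\mathbf O$ for $t\in[0,1]$, and let $\pi(\mathbf P)=\mathbf M^{1/2}\mathbf P\mathbf P^\top\mathbf M^{1/2}$. Then $\gamma(t)=(\pi\circ c)(t)$, $t\in[0,1]$, is a geodesic on $\mathcal M_{\rm gbw}$ between $\mathbf X$ and $\mathbf Y$ (that is, $\gamma(0)=\mathbf X$ and $\gamma(1)=\mathbf Y$).
   Context: $\mathbb S^n$ is the space of real symmetric $n\times n$ matrices and $\mathbb S^n_{++}$ the open subset of positive definite ones. For $\mathbf X,\mathbf M\in\mathbb S^n_{++}$ and $\mathbf U\in\mathbb S^n$, $\mathcal L_{\mathbf X,\mathbf M}[\mathbf U]$ is the unique solution $\mathbf L$ of $\mathbf X\mathbf L\mathbf M+\mathbf M\mathbf L\mathbf X=\mathbf U$. $\mathcal M_{\rm gbw}$ is the manifold $\mathbb S^n_{++}$ with the generalized Bures-Wasserstein metric $g_{\rm gbw}(\mathbf U,\mathbf V)=\frac12\operatorname{tr}(\mathcal L_{\mathbf X,\mathbf M}[\mathbf U]\mathbf V)$ at $\mathbf X$, $\mathbf U,\mathbf V\in T_{\mathbf X}\mathbb S^n_{++}=\mathbb S^n$. The orthogonal polar factor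 of an invertible matrix $\mathbf B$ is the orthogonal matrix $\mathbf B(\mathbf B^\top\mathbf B)^{-1/2}$; thus here $\mathbf O=\mathbf Y^{1/2}\mathbf M^{-1}\mathbf X^{1/2}(\mathbf X^{1/2}\mathbf M^{-1}\mathbf Y\mathbf M^{-1}\mathbf X^{1/2})^{-1/2}$. *)

(* Defs.v *)
From HB Require Import structures.
From mathcomp Require Import all_boot all_order all_algebra.
From mathcomp Require Import all_classical all_reals all_analysis.

Set Implicit Arguments.
Unset Strict Implicit.
Unset Printing Implicit Defensive.

Import Order.TTheory GRing.Theory Num.Theory.
Import numFieldNormedType.Exports.

Local Open Scope classical_set_scope.
Local Open Scope ring_scope.

Definition sym (R : realType) (n : nat) : set 'M[R]_n := [set A | A^T = A].

Definition spd (R : realType) (n : nat) : set 'M[R]_n :=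
  [set A | sym A /\ forall v : 'cV[R]_n, v != 0 -> 0 < (v^T *m A *m v) ord0 ord0].

(* The positive definite square root of A, which exists and is unique for A in
   spd; 0 is a junk value. *)
Definition sqrt_spd (R : realType) (n : nat) (A : 'M[R]_n) : 'M[R]_n :=
  xget 0 [set S | spd S /\ S *m S = A].

Definition orth_polar (R : realType) (n : nat) (B : 'M[R]_n) : 'M[R]_n :=
  B *m invmx (sqrt_spd (B^T *m B)).

(* For X, M in spd the equation has exactly one solution; 0 is a junk value. *)
Definition lyap (R : realType) (n : nat) (X M U : 'M[R]_n) : 'M[R]_n :=
  xget 0 [set L | X *m L *m M + M *m L *m X = U].

Definition g_gbw (R : realType) (n : nat) (M X U V : 'M[R]_n) : R :=
  2^-1 * \tr (lyap X M U *m V).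

(* spd is open in the vector space sym, so it has a global chart in which every
   tangent space is sym.  In this chart an affine connection reads
   nabla_U V = D_U V + Gamma_X(U, V) with Gamma_X : sym x sym -> sym bilinear.
   The Levi-Civita connection of a metric g X U V is the torsion-free one
   (Gamma symmetric) which is compatible with g; for fields U, V constant in the
   chart, compatibility is
   D_W (g(U, V)) = g(nabla_W U, V) + g(U, nabla_W V). *)
Record levi_civita (R : realType) (n : nat)
    (g : 'M[R]_n -> 'M[R]_n -> 'M[R]_n -> R)
    (Gamma : 'M[R]_n -> 'M[R]_n -> 'M[R]_n -> 'M[R]_n) : Prop := LeviCivita {
  lc_sym : forall X U V, spd X -> sym U -> sym V -> sym (Gamma X U V);
  lc_linear : forall X a U U' V, spd X -> sym U -> sym U' -> sym V ->
    Gamma X (a *: U + U') V = a *: Gamma X U V + Gamma X U' V;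
  lc_torsion_free : forall X U V, spd X -> sym U -> sym V ->
    Gamma X U V = Gamma X V U;
  lc_metric : forall X U V W, spd X -> sym U -> sym V -> sym W ->
    is_derive X W (fun Z => g Z U V)
      (g X (Gamma X W U) V + g X U (Gamma X W V))
}.

(* A smooth curve in spd, parametrized by [0, 1], with vanishing covariant
   acceleration nabla_(gamma') gamma' for the Levi-Civita connection of g.
   As usual for a curve on a closed interval, smoothness (existence of all
   iterated derivatives) is required on an open neighborhood of [0, 1]. *)
Definition geodesic (R : realType) (n : nat)
    (g : 'M[R]_n -> 'M[R]_n -> 'M[R]_n -> R) (gamma : R -> 'M[R]_n) : Prop :=
  [/\ forall t : R, t \in `[0, 1] -> spd (gamma t),
      exists2 e : R, 0 < e & forall (k : nat) (t : R), t \in `]- e, 1 + e[ ->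
        derivable (derive1n k gamma) t 1
    & exists2 Gamma, levi_civita g Gamma &
        forall t : R, t \in `[0, 1] ->
          derive1n 2 gamma t
            + Gamma (gamma t) (derive1 gamma t) (derive1 gamma t) = 0].

(* Main.v *)
(* Write L_U for the solution of X L M + M L X = U.  The Levi-Civita connection
   of the metric is Gamma_X(U, V) = - (M L_U X L_V M + M L_V X L_U M), because
   the derivative of tr(L_U V) along W is - tr(L_U (M L_V W + W L_V M)).
   The curve is gamma(t) = A(t) A(t)^T with A(t) = A0 + t D, A0 = X^(1/2) and
   D = Y^(1/2) O - X^(1/2).  By the choice of O, A0^T M^-1 Y^(1/2) O is positive
   definite, so that A(t) is invertible on [0, 1] and L = M^-1 D A(t)^-1 is
   symmetric.  Hence D = M L A(t), which gives gamma' = gamma L M + M L gamma and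
   gamma'' = 2 D D^T = 2 M L gamma L M = - Gamma_gamma(gamma', gamma'). *)

Require Import Defs.
From HB Require Import structures.
From mathcomp Require Import all_boot all_order all_algebra.
From mathcomp Require Import complex ring.
From mathcomp Require Import all_classical all_reals all_analysis.

Set Implicit Arguments.
Unset Strict Implicit.
Unset Printing Implicit Defensive.

Import Order.TTheory GRing.Theory Num.Theory.
Import numFieldNormedType.Exports.

Local Open Scope classical_set_scope.
Local Open Scope ring_scope.

(** * Polynomial interpolation *)

Lemma interpolation (F : fieldType) (f : F -> F) (s : seq F) :
  exists p : {poly F}, {in s, forall x, p.[x] = f x}.
Proof.
elim: s => [|x s [p ps]]; first by exists 0.
have [xs|xNs] := boolP (x \in s).
  by exists p => y; rewrite inE => /predU1P[->|]; exact: ps.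
(* [w] vanishes on [s] but not at [x], so adding a multiple of it corrects the value at [x] and
   keeps those on [s]. *)
pose w := \prod_(y <- s) ('X - y%:P).
have wx : w.[x] != 0 by rewrite -[_ == 0]/(root w x) root_prod_XsubC.
exists (p + ((f x - p.[x]) / w.[x])%:P * w) => y.
rewrite inE !hornerE => /predU1P[->|ys]; first by rewrite divfK// addrC subrK.
have /eqP-> : w.[y] == 0 by rewrite -[_ == 0]/(root w y) root_prod_XsubC.
by rewrite mulr0 addr0 ps.
Qed.

(** * The squared Frobenius norm as a trace *)

Section Trace.
Variables (R : realDomainType) (m n : nat).
Implicit Types A : 'M[R]_(m, n).

Lemma mxtrace_trmx_mul A : \tr (A^T *m A) = \sum_j \sum_i A i j ^+ 2.
Proof.
by apply: eq_bigr => j _; rewrite mxE; apply: eq_bigr => i _; rewrite mxE.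
Qed.

Lemma mxtrace_trmx_mul_ge0 A : 0 <= \tr (A^T *m A).
Proof.
by rewrite mxtrace_trmx_mul !sumr_ge0// => j _; rewrite sumr_ge0// => i _; rewrite sqr_ge0.
Qed.

Lemma mxtrace_trmx_mul_eq0 A : (\tr (A^T *m A) == 0) = (A == 0).
Proof.
apply/idP/eqP => [|->]; last by rewrite mulmx0 mxtrace0.
rewrite mxtrace_trmx_mul psumr_eq0 => [/allP A0|j _]; last first.
  by rewrite sumr_ge0// => i _; rewrite sqr_ge0.
apply/matrixP => i j; rewrite mxE; apply/eqP; rewrite -sqrf_eq0.
have := A0 j (mem_index_enum j); rewrite psumr_eq0 => [/allP/(_ i)|k _].
  by rewrite mem_index_enum; exact.
by rewrite sqr_ge0.
Qed.

End Trace.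

(** * Diagonalization and square roots of positive definite matrices *)

Section SquareRoot.
Variables (R : realType) (n : nat).
Implicit Types A S T Q : 'M[R]_n.

Lemma spd_mulmx_tr T : T \in unitmx -> spd (T *m T^T).
Proof.
move=> Tu; split=> [|v v0]; first by rewrite /sym/= trmx_mul trmxK.
have -> : v^T *m (T *m T^T) *m v = (T^T *m v)^T *m (T^T *m v).
  by rewrite trmx_mul trmxK !mulmxA.
rewrite -trace_mx11 lt_neqAle mxtrace_trmx_mul_ge0 andbT eq_sym.
rewrite mxtrace_trmx_mul_eq0; apply: contra_neq v0 => Tv0.
have Ttu : T^T \in unitmx by rewrite unitmx_tr.
by have := mulKmx Ttu v; rewrite Tv0 mulmx0.
Qed.

Lemma spd_unitmx A : spd A -> A \in unitmx.
Proof.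
move=> [_ Apos]; rewrite -unitmx_tr -row_free_unit -kermx_eq0.
apply/eqP/row_matrixP => i; rewrite row0; apply/eqP.
apply: contraTT isT => /= u0; set u := row i _ in u0.
have uA : u *m A^T = 0 by rewrite /u -row_mul mulmx_ker row0.
have := Apos u^T; rewrite trmx_eq0 => /(_ u0).
rewrite -mulmxA -[A]trmxK -trmx_mul uA trmx0 mulmx0 mxE ltxx//.
Qed.

(** The complex spectral theorem applies to [A] seen as a Hermitian matrix; since the spectrum is
    real, the similarity descends to the reals. *)
Lemma spd_diagonalization A : spd A ->
  exists Q (d : 'rV[R]_n),
    [/\ Q \in unitmx, Q *m A = diag_mx d *m Q & forall i, 0 < d 0 i].
Proof.
move=> [Asym Apos].
pose c (B : 'M[R]_n) := map_mx (real_complex R) B.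
have cr (B : 'M[R]_n) : c B \is a mxOver Num.real.
  by apply/mxOverP => i j; rewrite mxE complex_real.
have cK k (B : 'M[R[i]]_(k, n)) :
    B \is a mxOver Num.real -> B = map_mx (real_complex R) (map_mx (@complex.Re R) B).
  move=> /mxOverP Br; apply/matrixP => i j; rewrite !mxE.
  by rewrite RRe_real// Br.
have Ah : map_mx (real_complex R) A \is hermsymmx.
  apply: realsym_hermsym; last exact: cr.
  apply/is_hermitianmxP; rewrite expr0 scale1r; apply/matrixP => i j.
  by rewrite !mxE -{1}Asym mxE.
have /orthomx_spectralP Aeq := hermitian_normalmx Ah.
have := hermitian_spectral_diag_real Ah.
move: Aeq (spectral_unit (c A)); rewrite -/(c A).
set P := spectralmx _; set D := spectral_diag _ => Aeq Pu Dr.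
(* The unitary [P] is a complex similarity between two matrices with real entries; [real_similar]
   turns it into a real one. *)
have [Q /andP[/= Qr Qu] /(similarP Qu) QA] : exists2 Q,
    Q \in [predI (mxOver Num.real) & unitmx] & conjmx Q (c A) == diag_mx D.
  apply: real_similar; last 2 first.
  - exact: cr.
  - by apply/mxOverP => i j; rewrite mxE; case: eqP => // _; rewrite ?mulr1n ?(mxOverP Dr)// rpred0.
  exists P => //; apply/similarP => //.
  by rewrite Aeq !mulmxA mulmxV// mul1mx.
pose d := map_mx (@complex.Re R) D.
pose Q' := map_mx (@complex.Re R) Q.
have Q'u : Q' \in unitmx by rewrite -(map_unitmx (real_complex R)) -[map_mx _ _]cK.
have Q'A : Q' *m A = diag_mx d *m Q'.
  apply: (map_mx_inj (f := real_complex R)); rewrite !map_mxM map_diag_mx.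
  by rewrite -!cK.
exists Q', d; split=> // i.
(* The row [q] is a left eigenvector, so [q A q^T] is [d 0 i] times the squared norm of [q]. *)
pose q := row i Q'.
have qA : q *m A = d 0 i *: q by rewrite -row_mul Q'A mul_diag_mx; apply/rowP => j; rewrite !mxE.
have q0 : q != 0.
  apply: contraTneq Q'u => q0; apply/negP => Q'u.
  have := congr1 (fun B => B *m invmx Q') q0.
  rewrite -row_mul mulmxV// mul0mx row1 => /matrixP/(_ 0 i).
  by rewrite !mxE !eqxx => /eqP; rewrite oner_eq0.
have := Apos q^T; rewrite trmx_eq0 trmxK => /(_ q0).
rewrite qA -scalemxAl mxE pmulr_lgt0// -trace_mx11 -{1}[q]trmxK lt_neqAle eq_sym.
by rewrite mxtrace_trmx_mul_eq0 trmx_eq0 q0 mxtrace_trmx_mul_ge0.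
Qed.

Lemma trmx_horner_mx m (A : 'M[R]_m.+1) (p : {poly R}) :
  (horner_mx A p)^T = horner_mx A^T p.
Proof.
elim/poly_ind: p => [|p c IHp]; first by rewrite !raddf0.
rewrite !rmorphD !rmorphM/= !horner_mx_X !horner_mx_C raddfD/= tr_scalar_mx.
by rewrite trmx_mul IHp; congr (_ + _); exact: comm_mx_horner.
Qed.

End SquareRoot.

(* The root is a polynomial in A interpolating the square roots of the
   eigenvalues, hence symmetric; interpolating fourth roots instead writes it as
   T *m T with T symmetric, hence it is positive definite. *)
Lemma sqrt_spd_exists (R : realType) n (A : 'M[R]_n) :
  spd A -> exists S, spd S /\ S *m S = A.
Proof.
case: n A => [|n] A sA.
  by exists A; split=> //; rewrite [LHS]thinmx0 [RHS]thinmx0.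
have [Q [d [Qu QA d0]]] := spd_diagonalization sA.
have [p pd] := interpolation (fun x => Num.sqrt (Num.sqrt x)) [seq d 0 i | i : 'I_n.+1].
pose T := horner_mx A p.
have Tt : T^T = T by rewrite trmx_horner_mx; case: sA => ->.
have T4 : T *m T *m (T *m T) = A.
  have -> : T *m T *m (T *m T) = horner_mx A (p * p * (p * p)).
    by rewrite !rmorphM.
  have AE : A = invmx Q *m diag_mx d *m invmx (invmx Q).
    by rewrite invmxK -mulmxA -QA mulKmx.
  rewrite [in LHS]AE horner_mx_uconj ?unitmx_inv// horner_mx_diag [RHS]AE.
  congr (_ *m diag_mx _ *m _); apply/rowP => i; rewrite mxE !hornerE /=.
  rewrite pd ?map_f ?mem_enum// -mulrA -!expr2.
  by rewrite sqr_sqrtr ?sqrtr_ge0// sqr_sqrtr// ltW.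
have Tu : T \in unitmx.
  by have := spd_unitmx sA; rewrite -T4 !unitmx_mul => /andP[/andP[]].
by exists (T *m T); split=> //; rewrite -{2}Tt; exact: spd_mulmx_tr.
Qed.

Lemma sqrt_spdP (R : realType) n (A : 'M[R]_n) :
  spd A -> spd (sqrt_spd A) /\ sqrt_spd A *m sqrt_spd A = A.
Proof. by move=> sA; exact: (xgetPex 0 (sqrt_spd_exists sA)). Qed.

(** * The equation [X L M + M L X = U] *)

Section Lyapunov.
Variables (R : realType) (n : nat).
Implicit Types X M U V W L : 'M[R]_n.

(* tr(L^T (X L M + M L X)) is a sum of two squared Frobenius norms. *)
Lemma lyap_kernel X M L : spd X -> spd M ->
  X *m L *m M + M *m L *m X = 0 -> L = 0.
Proof.
move=> sX sM XLM.
have [[Sxs Sxp] Sx2] := sqrt_spdP sX; have [[Sms Smp] Sm2] := sqrt_spdP sM.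
set S := sqrt_spd X in Sxs Sxp Sx2; set T := sqrt_spd M in Sms Smp Sm2.
have tr0 A B (K : 'M[R]_n) : sym A -> sym B ->
    \tr (K^T *m (A *m A *m K *m (B *m B))) = \tr ((A *m K *m B)^T *m (A *m K *m B)).
  move=> As Bs; rewrite !trmx_mul As Bs !mulmxA mxtrace_mulC !mulmxA.
  by rewrite -[B *m _ *m A]mulmxA.
have : \tr (L^T *m (X *m L *m M + M *m L *m X)) = 0 by rewrite XLM mulmx0 mxtrace0.
rewrite mulmxDr mxtraceD -{1}Sx2 -{1}Sm2 -[in X in _ + X]Sx2 -[in X in _ + X]Sm2.
rewrite !tr0// => /eqP; rewrite paddr_eq0 ?mxtrace_trmx_mul_ge0// => /andP[].
rewrite mxtrace_trmx_mul_eq0 => /eqP SLT0 _.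
have Su : S \in unitmx by exact: spd_unitmx.
have Tu : T \in unitmx by exact: spd_unitmx.
by rewrite -[L](mulKmx Su) -[S *m L](mulmxK Tu) SLT0 mul0mx mulmx0.
Qed.

Definition lyap_op X M L := X *m L *m M + M *m L *m X.

Fact lyap_op_is_linear X M : linear (lyap_op X M).
Proof.
move=> a U V; rewrite /lyap_op !mulmxDr !mulmxDl -!scalemxAr -!scalemxAl.
by rewrite addrACA -scalerDr.
Qed.
HB.instance Definition _ X M :=
  GRing.isLinear.Build R 'M[R]_n 'M[R]_n _ (lyap_op X M) (lyap_op_is_linear X M).

(** On vectorized matrices, unique solvability becomes invertibility of a matrix, which persists
    under small perturbations of [X]. *)
Definition lyap_mx X M := lin_mx (lyap_op X M).

Lemma lyap_mx_unit X M : spd X -> spd M -> lyap_mx X M \in unitmx.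
Proof.
move=> sX sM; rewrite -row_free_unit -kermx_eq0.
apply/eqP/row_matrixP => i; rewrite row0; set u := row i _.
have : u *m lyap_mx X M = 0 by rewrite /u -row_mul mulmx_ker row0.
rewrite -[u]vec_mxK mul_vec_lin => /(canRL mxvecK).
rewrite linear0 => /(lyap_kernel sX sM) ->; exact: linear0.
Qed.

(** Assuming invertibility rather than [spd X] lets this and the next lemmas apply at [X + h *: W]
    for small [h]. *)
Lemma lyapE X M U L : lyap_mx X M \in unitmx ->
  lyap X M U = vec_mx (mxvec U *m invmx (lyap_mx X M)).
Proof.
move=> Ku; apply: xget_unique => [/=|L' /= L'E].
  set L0 := vec_mx _; rewrite -[LHS]/(lyap_op X M L0); apply: (can_inj mxvecK).
  by rewrite -mul_vec_lin vec_mxK mulmxKV.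
by rewrite -[LHS]mxvecK; congr (vec_mx _); rewrite -L'E -[_ + _]/(lyap_op X M L') -mul_vec_lin mulmxK.
Qed.

Lemma lyapP X M U : lyap_mx X M \in unitmx -> lyap_op X M (lyap X M U) = U.
Proof.
move=> Ku; apply: (can_inj mxvecK).
by rewrite -mul_vec_lin lyapE// vec_mxK mulmxKV.
Qed.

Lemma lyap_unique X M U L : lyap_mx X M \in unitmx ->
  lyap_op X M L = U -> lyap X M U = L.
Proof.
move=> Ku <-; apply: (can_inj mxvecK).
by rewrite lyapE// vec_mxK -mul_vec_lin mulmxK.
Qed.

Lemma lyap_linear X M a U V : spd X -> spd M ->
  lyap X M (a *: U + V) = a *: lyap X M U + lyap X M V.
Proof.
move=> sX sM; apply: lyap_unique; first exact: lyap_mx_unit.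
by rewrite linearP/= !lyapP ?lyap_mx_unit.
Qed.

(** Transposition swaps the two terms of the equation, so the transpose of the solution is again a
    solution. *)
Lemma lyap_sym X M U : spd X -> spd M -> sym U -> sym (lyap X M U).
Proof.
move=> sX sM Us; have Ku := lyap_mx_unit sX sM.
apply/esym; apply: (lyap_unique Ku).
rewrite -[RHS]Us -{2}(lyapP U Ku) /lyap_op linearD/= !trmx_mul.
by case: sX sM => -> _ [-> _]; rewrite addrC !mulmxA.
Qed.

End Lyapunov.

(** * Continuity of determinants and adjugates along a line *)

Section Line.
Variable R : realType.

(** The line with a formal parameter: its determinant and adjugate entries are polynomials, whose
    evaluations are continuous. *)
Definition line_mx n (A B : 'M[R]_n) : 'M[{poly R}]_n :=
  map_mx polyC A + 'X *: map_mx polyC B.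

Let horner_evalC m k (h : R) (A : 'M[R]_(m, k)) :
  map_mx (horner_eval h) (map_mx polyC A) = A.
Proof. by rewrite -map_mx_comp map_mx_id// => x; rewrite /= /horner_eval hornerC. Qed.

Lemma map_line_mx n (A B : 'M[R]_n) h : map_mx (horner_eval h) (line_mx A B) = A + h *: B.
Proof. by rewrite map_mxD map_mxZ/= !horner_evalC /horner_eval hornerX. Qed.

Lemma det_line_continuous n (A B : 'M[R]_n) : continuous (fun h : R => \det (A + h *: B)).
Proof.
suff -> : (fun h : R => \det (A + h *: B)) = horner (\det (line_mx A B)).
  exact: continuous_horner.
by apply/funext => h; rewrite -map_line_mx det_map_mx.
Qed.

Lemma adj_line_continuous k (A B : 'M[R]_(k * k)) (u : 'rV[R]_(k * k)) C :
  continuous (fun h : R => \tr (vec_mx (u *m \adj (A + h *: B)) *m C)).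
Proof.
pose p := \tr (vec_mx (map_mx polyC u *m \adj (line_mx A B)) *m map_mx polyC C).
suff -> : (fun h : R => \tr (vec_mx (u *m \adj (A + h *: B)) *m C)) = horner p.
  exact: continuous_horner.
apply/funext => h; rewrite -[RHS]/(horner_eval h p) -trace_map_mx map_mxM.
by rewrite map_vec_mx map_mxM map_mx_adj map_line_mx !horner_evalC.
Qed.
End Line.

(** * Directional derivative of the metric in the base point *)

Section Derivative.
Variables (R : realType) (n : nat).
Implicit Types X M U V W L B : 'M[R]_n.

Lemma lyap_mx_line X M W h : lyap_mx (X + h *: W) M = lyap_mx X M + h *: lyap_mx W M.
Proof.
apply/row_matrixP => i; rewrite rowE [RHS]rowE mulmxDr -scalemxAr !mul_rV_lin.
rewrite -linearZ -linearD/=; congr mxvec.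
rewrite /lyap_op !mulmxDr !mulmxDl scalerDr -!scalemxAr -!scalemxAl.
by rewrite addrACA.
Qed.

Lemma lyap_mx_line_unit X M W : lyap_mx X M \in unitmx ->
  \forall h \near (0 : R), lyap_mx (X + h *: W) M \in unitmx.
Proof.
rewrite unitmxE unitfE => K0.
have /cvgr_neq0 : (fun h : R => \det (lyap_mx X M + h *: lyap_mx W M)) @ 0
    --> \det (lyap_mx X M + (0 : R) *: lyap_mx W M).
  exact: det_line_continuous.
rewrite scale0r addr0 => /(_ K0); apply: filterS => h.
by rewrite lyap_mx_line unitmxE unitfE.
Qed.

(* Cramer's rule writes the left-hand side as a quotient of polynomials in h. *)
Lemma lyap_line_cvg X M U W B : lyap_mx X M \in unitmx ->
  (fun h : R => \tr (lyap (X + h *: W) M U *m B)) @ (0 : R)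
    --> \tr (lyap X M U *m B).
Proof.
move=> Ku.
have K0 : \det (lyap_mx X M) != 0 by rewrite -unitfE -unitmxE.
have eqL h : lyap_mx (X + h *: W) M \in unitmx ->
  \tr (lyap (X + h *: W) M U *m B) =
    (\det (lyap_mx X M + h *: lyap_mx W M))^-1 *
    \tr (vec_mx (mxvec U *m \adj (lyap_mx X M + h *: lyap_mx W M)) *m B).
  move=> Khu; rewrite lyapE// {1}/invmx Khu lyap_mx_line.
  by rewrite -scalemxAr linearZ/= -scalemxAl mxtraceZ.
have cd := @det_line_continuous _ _ (lyap_mx X M) (lyap_mx W M) 0.
have ca := @adj_line_continuous _ _ (lyap_mx X M) (lyap_mx W M) (mxvec U) B 0.
have := eqL 0; rewrite scale0r addr0 => /(_ Ku) ->.
apply: cvg_trans (cvgM (cvgV _ cd) ca); last by rewrite scale0r addr0.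
apply: near_eq_cvg; have := lyap_mx_line_unit W Ku.
by apply: filterS => h /eqL ->.
Qed.

(** Once [U] and [V] are expressed through their solutions, the two sides agree by cyclicity of the
    trace. *)
Lemma lyap_self_adjoint X M U V : lyap_mx X M \in unitmx ->
  \tr (lyap X M U *m V) = \tr (U *m lyap X M V).
Proof.
move=> Ku; rewrite -{1}(lyapP V Ku) -{2}(lyapP U Ku) /lyap_op.
rewrite !mulmxDr !mulmxDl !mxtraceD addrC; congr (_ + _).
  by rewrite !mulmxA [LHS]mxtrace_mulC !mulmxA.
by rewrite !mulmxA [LHS]mxtrace_mulC !mulmxA.
Qed.

Lemma lyap_trace_is_derive X M U V W : spd X -> spd M ->
  is_derive X W (fun Z => \tr (lyap Z M U *m V))
    (- \tr (lyap X M U *m (M *m lyap X M V *m W + W *m lyap X M V *m M))).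
Proof.
move=> sX sM; have Ku := lyap_mx_unit sX sM.
set B := (X in _ *m X).
suff dq : (fun h : R => h^-1 *: (((fun Z => \tr (lyap Z M U *m V)) \o shift X) (h *: W)
    - \tr (lyap X M U *m V))) @ 0^' --> - \tr (lyap X M U *m B).
  by split; [apply/cvg_ex; exists (- \tr (lyap X M U *m B)) | exact: cvg_lim].
apply: cvg_trans (@cvg_within_filter _ _ _ (nbhs (0 : R)) _ _ (fun h => h != 0)
  (cvgN (@lyap_line_cvg X M U W B Ku))).
apply: near_eq_cvg.
near=> h.
have h0 : h != 0 by near: h; exact: nbhs_dnbhs_neq.
have Khu : lyap_mx (X + h *: W) M \in unitmx.
  by near: h; apply: nbhs_dnbhs; exact: lyap_mx_line_unit.
rewrite /= [h *: W + X]addrC; set L := lyap (X + _) M U.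
(* Resolvent identity: subtract the equations at [X + h *: W] and at [X]. Self-adjointness then
   moves the inverse onto [V], and the quotient by [h] involves only [L], whose limit is known. *)
have LE : lyap_op X M (L - lyap X M U) = - (h *: lyap_op W M L).
  rewrite linearB/= lyapP// -[X in _ - X](lyapP U Khu) -/L.
  rewrite /lyap_op !mulmxDr !mulmxDl -!scalemxAr -!scalemxAl scalerDr.
  by rewrite [X in _ - X]addrACA opprD addrA subrr add0r.
rewrite -linearB/= -mulmxBl -(lyap_unique Ku LE) lyap_self_adjoint//.
rewrite mulNmx -scalemxAl linearN linearZ/= scalerN [_ *: _]mulrA mulVf// mul1r.
congr (- _); rewrite /lyap_op mulmxDl mulmxDr !mxtraceD.
by congr (_ + _); rewrite -!mulmxA [RHS]mxtrace_mulC -!mulmxA.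
Unshelve. all: by end_near. Qed.
End Derivative.

(** * The Levi-Civita connection of the metric *)

Section LeviCivita.
Variables (R : realType) (n : nat).
Implicit Types X M U V W : 'M[R]_n.

Definition christoffel_gbw M X U V : 'M[R]_n :=
  - (M *m lyap X M U *m X *m lyap X M V *m M
     + M *m lyap X M V *m X *m lyap X M U *m M).

Lemma levi_civita_gbw M : spd M -> levi_civita (g_gbw M) (christoffel_gbw M).
Proof.
move=> sM; split=> [X U V sX Us Vs|X a U U' V sX _ _ _|X U V _ _ _|X U V W sX _ _ _].
- rewrite /sym/= /christoffel_gbw linearN linearD/= !trmx_mul.
  rewrite (lyap_sym sX sM Us) (lyap_sym sX sM Vs).
  by case: sX sM => -> _ [-> _]; rewrite addrC !mulmxA.
- rewrite /christoffel_gbw lyap_linear// !(mulmxDr, mulmxDl) -!(scalemxAr, scalemxAl).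
  by rewrite addrACA -scalerDr opprD scalerN.
- by rewrite /christoffel_gbw addrC.
- have Ku := lyap_mx_unit sX sM.
  apply: is_derive_eq (is_deriveZ 2^-1 (lyap_trace_is_derive U V W sX sM)) _.
  (* Self-adjointness avoids solving the equation with a Christoffel term on the right-hand side. *)
  rewrite /g_gbw (lyap_self_adjoint (christoffel_gbw M X W U) V Ku) -mulrDr; congr (_ * _).
  rewrite /christoffel_gbw -{1 2}(lyapP W Ku) /lyap_op.
  move: (lyap X M U) (lyap X M V) (lyap X M W) => A B C.
  have trN (K : 'M[R]_n) : \tr (- K) = - \tr K by rewrite raddfN.
  rewrite mulNmx mulmxN !trN -opprD; congr (- _).
  rewrite !mulmxDr !mulmxDl !mulmxDr. rewrite !mulmxA. rewrite !mxtraceD.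
  (* Each side is now a sum of four traces of words; two words match literally, the other two after
     a cyclic rotation. *)
  have -> : \tr (A *m M *m B *m M *m C *m X) = \tr (M *m C *m X *m A *m M *m B).
    transitivity (\tr (A *m M *m B *m (M *m C *m X))); first by rewrite !mulmxA.
    by rewrite mxtrace_mulC !mulmxA.
  have -> : \tr (A *m X *m C *m M *m B *m M) = \tr (M *m A *m X *m C *m M *m B).
    by rewrite mxtrace_mulC !mulmxA.
  ring.
Qed.

End LeviCivita.

(** * Derivatives of quadratic curves *)

Section QuadraticCurve.
Variables (R : realType) (V : normedModType R).
Implicit Types a b c : V.

(** A family stable under differentiation, so derivatives of every order exist by induction. *)
Definition quadratic_curve a b c (t : R) := a + t *: b + t ^+ 2 *: c.

Lemma is_derive_quadratic_curve a b c (t : R) :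
  is_derive t 1 (quadratic_curve a b c) (b + t *: (c *+ 2)).
Proof.
suff dq : (fun h : R => h^-1 *: ((quadratic_curve a b c \o shift t) (h *: 1)
    - quadratic_curve a b c t)) @ 0^' --> b + t *: (c *+ 2).
  by split; [apply/cvg_ex; exists (b + t *: (c *+ 2)) | exact: cvg_lim].
(* This function is the difference quotient for nonzero [h]. *)
have cl : (fun h : R => b + t *: (c *+ 2) + h *: c) @ 0 --> b + t *: (c *+ 2).
  rewrite -[X in _ --> X]addr0 -[X in _ --> _ + X](scale0r c).
  by apply: cvgD; [exact: cvg_cst | exact: scalel_continuous].
apply: cvg_trans (@cvg_within_filter _ _ _ (nbhs (0 : R)) _ _ (fun h => h != 0) cl).
apply: near_eq_cvg; near=> h.
have h0 : h != 0 by near: h; exact: nbhs_dnbhs_neq.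
apply: (scalerI h0); rewrite scalerA mulfV// scale1r /= [h *: 1]mulr1.
rewrite /quadratic_curve.
have -> : (h + t) ^+ 2 *: c = t ^+ 2 *: c + (h *: (t *: (c *+ 2)) + h *: (h *: c)).
  by rewrite -scaler_nat !scalerA -!scalerDl; congr (_ *: _); ring.
apply: (addIr (a + t *: b + t ^+ 2 *: c)); rewrite subrK !scalerDr scalerDl.
by rewrite [RHS](AC ((1*2)*(1*2)) ((2*5*6)*(1*3*4))).
Unshelve. all: by end_near. Qed.

Lemma derive1_quadratic_curve a b c :
  derive1 (quadratic_curve a b c) = quadratic_curve b (c *+ 2) 0.
Proof.
apply/funext => t; rewrite derive1E.
by have [_ ->] := is_derive_quadratic_curve a b c t; rewrite /quadratic_curve scaler0 addr0.
Qed.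

Lemma derivable_derive1n_quadratic_curve a b c k (t : R) :
  derivable (derive1n k (quadratic_curve a b c)) t 1.
Proof.
elim: k a b c => [|k IHk] a b c.
  by have [] := is_derive_quadratic_curve a b c t.
by rewrite derive1Sn derive1_quadratic_curve.
Qed.

End QuadraticCurve.

(** * Horizontal lines project to geodesics *)

Section Geodesic.
Variables (R : realType) (n : nat).
Implicit Types M A D L : 'M[R]_n.

(** The condition on [D] is horizontality for the map [A |-> A A^T] and the inner product
    [tr(D^T M^-1 E)]; [L] is then the solution for the velocity. *)
Lemma geodesic_horizontal_line M A D : spd M ->
  (forall t : R, t \in `[0, 1] -> A + t *: D \in unitmx) ->
  (forall t : R, t \in `[0, 1] ->
     exists2 L, sym L & D = M *m L *m (A + t *: D)) ->
  geodesic (g_gbw M) (fun t => (A + t *: D) *m (A + t *: D)^T).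
Proof.
move=> sM Au DL.
have curveE : (fun t => (A + t *: D) *m (A + t *: D)^T) =
    quadratic_curve (A *m A^T) (A *m D^T + D *m A^T) (D *m D^T).
  apply/funext => t; rewrite /quadratic_curve linearD/= linearZ/= mulmxDr !mulmxDl.
  rewrite -!scalemxAr -!scalemxAl scalerA scalerDr -expr2 !addrA.
  by congr (_ + _); rewrite addrAC.
split=> [t t01||].
- exact/spd_mulmx_tr/Au.
(* The margin [1] is arbitrary: the curve is polynomial on the whole line. *)
- exists 1 => // k t _; rewrite curveE; exact: derivable_derive1n_quadratic_curve.
- exists (christoffel_gbw M); first exact: levi_civita_gbw.
  move=> t t01; have [L Ls DE] := DL t t01.
  rewrite curveE derive1Sn derive1n1 !derive1_quadratic_curve.
  rewrite /quadratic_curve mul0rn !scaler0 !addr0.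
  set U := A *m D^T + _ + _.
  have UE : U = (A + t *: D) *m D^T + D *m (A + t *: D)^T.
    rewrite [(A + _)^T]linearD/= [(t *: D)^T]linearZ/= mulmxDl mulmxDr.
    by rewrite -scalemxAl -scalemxAr /U mulr2n scalerDr [RHS]addrACA.
  move: (Au t t01) DE UE; set B := A + t *: D => Bu DE UE.
  have sX : spd (B *m B^T) by exact: spd_mulmx_tr.
  have Ms : M^T = M by case: sM.
  have DTE : D^T = B^T *m L *m M by rewrite DE !trmx_mul Ms Ls mulmxA.
  have LE : lyap (B *m B^T) M U = L.
    apply: (lyap_unique (lyap_mx_unit sX sM)).
    by rewrite UE DTE DE /lyap_op !mulmxA.
  by rewrite /christoffel_gbw LE -mulr2n DTE DE !mulmxA subrr.
Qed.

End Geodesic.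

(** * Polar factors and the line between two factors *)

Section OptimalLine.
Variables (R : realType) (n : nat).
Implicit Types M A B P Q S : 'M[R]_n.

Lemma spd_convex P Q (t : R) : t \in `[0, 1] -> spd P -> spd Q ->
  spd ((1 - t) *: P + t *: Q).
Proof.
rewrite in_itv/= => /andP[t0 t1] [Ps Pp] [Qs Qp]; split=> [|v v0].
  by rewrite /sym/= linearD/= !linearZ/= Ps Qs.
rewrite mulmxDr mulmxDl -!scalemxAr -!scalemxAl !mxE.
have := Pp v v0; have := Qp v v0; rewrite !mxE => q0 p0.
have [->|tN0] := eqVneq t 0; first by rewrite subr0 mul1r mul0r addr0.
by rewrite ltr_wpDl ?mulr_ge0 ?subr_ge0 ?(ltW p0)// mulr_gt0// lt_neqAle eq_sym tN0.
Qed.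

Lemma spd_inv M : spd M -> spd (invmx M).
Proof.
move=> sM; have Mu := spd_unitmx sM.
have Ms : M^T = M by case: sM.
have [[Ts Tp] T2] := sqrt_spdP sM; set T := sqrt_spd M in Ts Tp T2.
have Tu : T \in unitmx by exact: spd_unitmx.
suff -> : invmx M = invmx T *m (invmx T)^T by apply: spd_mulmx_tr; rewrite unitmx_inv.
rewrite trmx_inv Ts; apply: (can_inj (mulKmx Mu)).
by rewrite mulmxV// -T2 -mulmxA mulKVmx// mulmxV.
Qed.

Lemma sym_congr A P : sym P -> sym (A^T *m P *m A).
Proof. by move=> Ps; rewrite /sym/= !trmx_mul trmxK Ps mulmxA. Qed.

Lemma spd_congr A P : A \in unitmx -> spd P -> spd (A^T *m P *m A).
Proof.
move=> Au [Ps Pp]; split=> [|v v0]; first exact: sym_congr.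
have := Pp (A *m v); rewrite trmx_mul !mulmxA; apply.
by apply: contra_neq v0 => Av0; rewrite -[v](mulKmx Au) Av0 mulmx0.
Qed.

Section OrthPolar.
Variable B : 'M[R]_n.
Hypothesis Bu : B \in unitmx.
Let S := sqrt_spd (B^T *m B).

Let S_spd : spd S /\ S *m S = B^T *m B.
Proof.
apply: sqrt_spdP; rewrite -{2}[B]trmxK; apply: spd_mulmx_tr.
by rewrite unitmx_tr.
Qed.

Let Su : S \in unitmx. Proof. by case: S_spd => /spd_unitmx. Qed.

(** This identity provides the positive definiteness assumed in [geodesic_line]. *)
Lemma trmx_mul_orth_polar : B^T *m orth_polar B = S.
Proof. by rewrite /orth_polar -/S mulmxA -S_spd.2 mulmxK. Qed.

Lemma orth_polar_mul_trmx : orth_polar B *m (orth_polar B)^T = 1%:M.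
Proof.
apply: mulmx1C; rewrite {1}/orth_polar trmx_mul -mulmxA trmx_mul_orth_polar.
by rewrite trmx_inv; case: S_spd => -[-> _] _; rewrite mulVmx.
Qed.

End OrthPolar.

Lemma geodesic_line M A0 A1 : spd M -> A0 \in unitmx ->
  spd (A0^T *m invmx M *m A1) ->
  geodesic (g_gbw M)
    (fun t => (A0 + t *: (A1 - A0)) *m (A0 + t *: (A1 - A0))^T).
Proof.
move=> sM A0u sS; have Mu := spd_unitmx sM.
have sA0 := spd_congr A0u (spd_inv sM).
(* Multiplied on the left by [A0^T M^-1], the line becomes a segment between two positive definite
   matrices. *)
have Au (t : R) : t \in `[0, 1] -> A0 + t *: (A1 - A0) \in unitmx.
  move=> /spd_convex/(_ sA0 sS)/spd_unitmx.
  have -> : (1 - t) *: (A0^T *m invmx M *m A0) + t *: (A0^T *m invmx M *m A1) =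
      A0^T *m invmx M *m (A0 + t *: (A1 - A0)).
    rewrite mulmxDr -scalemxAr mulmxBr scalerBl scalerBr scale1r.
    by rewrite -!addrA [- _ + _]addrC.
  by rewrite unitmx_mul => /andP[].
apply: geodesic_horizontal_line => // t t01; have {}Au := Au t t01.
set D := A1 - A0 in Au *; set A := A0 + t *: D in Au *.
(* The witness solves [D = M L A] for [L]; it is congruent to [A^T M^-1 D], which splits into
   symmetric terms. *)
exists (invmx M *m D *m invmx A); last by rewrite !mulmxA mulmxV// mul1mx mulmxKV.
have Hs : sym (A^T *m invmx M *m D).
  have -> : A^T *m invmx M *m D =
      A0^T *m invmx M *m A1 - A0^T *m invmx M *m A0 + t *: (D^T *m invmx M *m D).
    by rewrite /A [(A0 + _)^T]linearD/= [(t *: D)^T]linearZ/= !mulmxDl -!scalemxAl {1}/D mulmxBr.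
  rewrite /sym/= [LHS]linearD/= [X in X + _]linearB/= [X in _ + X]linearZ/=.
  by rewrite (sym_congr D (spd_inv sM).1) sS.1 sA0.1.
have -> : invmx M *m D *m invmx A = (invmx A)^T *m (A^T *m invmx M *m D) *m invmx A.
  by rewrite !mulmxA -trmx_mul mulmxV// trmx1 mul1mx.
exact: sym_congr.
Qed.

End OptimalLine.

Theorem proposition8 (R : realType) (n : nat) (M X Y : 'M[R]_n)
    (hM : spd M) (hX : spd X) (hY : spd Y) :
  let O := orth_polar (sqrt_spd Y *m invmx M *m sqrt_spd X) in
  let c := fun t : R =>
    (1 - t) *: (invmx (sqrt_spd M) *m sqrt_spd X)
      + t *: (invmx (sqrt_spd M) *m sqrt_spd Y *m O) in
  let proj := fun P : 'M[R]_n => sqrt_spd M *m P *m P^T *m sqrt_spd M in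
  let gamma := proj \o c in
  [/\ geodesic (g_gbw M) gamma, gamma 0 = X & gamma 1 = Y].
Proof.
have [sSM SM2] := sqrt_spdP hM; have [sSX SX2] := sqrt_spdP hX.
have [sSY SY2] := sqrt_spdP hY.
move: (sqrt_spd M) (sqrt_spd X) (sqrt_spd Y) sSM SM2 sSX SX2 sSY SY2.
move=> N SX SY sN N2 sSX SX2 sSY SY2 O c proj gamma.
have Nu := spd_unitmx sN; have [Ns _] := sN.
have [SXs _] := sSX; have [SYs _] := sSY.
pose B := SY *m invmx M *m SX.
have Bu : B \in unitmx.
  by rewrite !unitmx_mul unitmx_inv !spd_unitmx.
(* The outer factors [N] of [proj] cancel the inverse of [N] in [c]. *)
have gammaE : gamma = fun t => (SX + t *: (SY *m O - SX)) *m (SX + t *: (SY *m O - SX))^T.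
  apply/funext => t; rewrite /gamma/= /proj.
  have -> : SX + t *: (SY *m O - SX) = N *m c t.
    rewrite /c mulmxDr -!scalemxAr -!mulmxA !mulKVmx//.
    by rewrite scalerBl scalerBr scale1r -addrA [- _ + _]addrC.
  by rewrite trmx_mul Ns !mulmxA.
rewrite gammaE; split.
- apply: geodesic_line => //; first exact: spd_unitmx.
  have -> : SX^T *m invmx M *m (SY *m O) = B^T *m orth_polar B.
    have [Ms _] := spd_inv hM.
    by rewrite /B !trmx_mul SXs SYs Ms !mulmxA.
  rewrite trmx_mul_orth_polar//; apply: (sqrt_spdP _).1.
  by rewrite -{2}[B]trmxK; apply: spd_mulmx_tr; rewrite unitmx_tr.
- by rewrite scale0r addr0 SXs.
(* At the endpoint [O O^T = 1] leaves [SY *m SY]. *)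
- rewrite scale1r addrC subrK trmx_mul SYs mulmxA -[SY *m O *m _]mulmxA.
  by rewrite orth_polar_mul_trmx// mulmx1.
Qed.
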